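(* Let $Q$ be the transition function of a downward run chain on the poset $(S, \preceq)$, and let $\hat Q$ be the transition function on the path space $\hat S$ given by $$\hat Q(e, e\,x_1 \cdots x_n) = Q(e, x_n) Q(x_n, x_{n-1}) \cdots Q(x_1, e), \qquad e\,x_1 \cdots x_n \in \hat S,\ n \ge 1,$$ $$\hat Q(e,e) = Q(e,e), \qquad \hat Q(a, a^-) = 1, \quad a \in \hat S - \{e\}.$$ If $\hat{\boldsymbol{Y}} = (\hat Y_0, \hat Y_1, \ldots)$ is a downward run chain on $\hat S$ with transition function $\hat Q$ and starting at $e$, then the process $\boldsymbol{Y} = (Y_0, Y_1, \ldots)$ defined by $Y_n = m(\hat Y_n)$ is a downward run chain on $S$ with transition function $Q$ and starting at $e$.
   Context: $(S, \preceq)$ is a discrete (countable) partially ordered set with a minimum element $e$, such that for every $x \in S$ every chain (totally ordered subset) in $S$ from $e$ to $x$ is finite. An element $y$ covers $x$ if $y$ is a minimal element of $\{t \in S : t \succ x\}$; $B_x = \{w \in S : x \text{ covers } w\}$. The covering graph is the directed graph on $S$ with an edge $(x,y)$ whenever $y$ covers $x$. A downward run chain on such a poset is a (time-homogeneous, discrete-time) Markov chain whose transition function $Q$ satisfies $Q(x,y) > 0$ if and only if either $x = e$ and $y$ is any state, or $x \ne e$ and $y \in B_x$. Path space: $\hat S$ is the set of finite directed paths in the covering graph of $S$ starting at $e$, partially ordered by $a \preceq b$ iff $a$ is a prefix of $b$. Its minimum element is the degenerate path consisting only of $e$, also denoted $e$, and its covering graph is a tree rooted at $e$. For $a \in \hat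 S$, $m(a) \in S$ is the endpoint of $a$, and for $a \neq e$, $a^-$ is the path obtained from $a$ by removing its endpoint (the unique element of $\hat S$ covered by $a$). *)

(* Defs.v *)
From HB Require Import structures.
From mathcomp Require Export all_boot all_order all_algebra.
From mathcomp Require Export all_classical all_reals all_analysis.

Set Implicit Arguments.
Unset Strict Implicit.
Unset Printing Implicit Defensive.

Export Order.TTheory GRing.Theory Num.Theory.

Local Open Scope classical_set_scope.
Local Open Scope order_scope.

Definition chain_between (d : Order.disp_t) (S : porderType d) (x y : S)
    (C : set S) : Prop :=
  [/\ total_on C (fun s t => s <= t), C x, C y &
      forall t, C t -> x <= t <= y].

(* The minimum element e is [\bot]. *)
Definition discrete_poset (d : Order.disp_t) (S : bPOrderType d) : Prop :=
  countable [set: S] /\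
  forall (x : S) (C : set S), chain_between \bot x C -> finite_set C.

(* [covers x y] reads "y covers x". *)
Definition covers (d : Order.disp_t) (S : porderType d) (x y : S) : Prop :=
  let above := [set t : S | x < t] in
  above y /\ ~ exists2 t, above t & t < y.

(* The set B_x. *)
Definition covered_by (d : Order.disp_t) (S : porderType d) (x : S) : set S :=
  [set w | covers w x].

(** * Path space *)

(* The path e x_1 ... x_n is encoded by [:: x_1; ...; x_n]; its starting point
   e is left implicit, so the degenerate path is [::]. *)
Definition covering_path (d : Order.disp_t) (S : bPOrderType d) : pred (seq S) :=
  path (fun x y : S => `[< covers x y >]) \bot.

Record path_space (d : Order.disp_t) (S : bPOrderType d) : Type := PathSpace {
  path_seq :> seq S;
  _ : covering_path path_seq
}.

HB.instance Definition _ (d : Order.disp_t) (S : bPOrderType d) :=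
  [isSub for @path_seq d S].
HB.instance Definition _ (d : Order.disp_t) (S : bPOrderType d) :=
  [Choice of path_space S by <:].

Section PathSpaceOrder.
Context (d : Order.disp_t) (S : bPOrderType d).
Implicit Types a b : path_space S.

Definition path_le a b : bool := prefix a b.

Fact path_le_refl : reflexive path_le.
Proof. by move=> a; exact: prefix_refl. Qed.

Fact path_le_anti : antisymmetric path_le.
Proof.
move=> a b /andP[]; rewrite /path_le => ab ba; apply: val_inj => /=.
move: ab; rewrite prefixE => /eqP <-; rewrite take_oversize//.
exact: size_prefix.
Qed.

Fact path_le_trans : transitive path_le.
Proof. by move=> b a c; exact: prefix_trans. Qed.

HB.instance Definition _ :=
  Order.Le_isPOrder.Build d (path_space S)
    path_le_refl path_le_anti path_le_trans.

Definition path0 : path_space S := @PathSpace d S [::] isT.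

Fact path0_le a : path0 <= a.
Proof. exact: prefix0s. Qed.

HB.instance Definition _ := Order.hasBottom.Build d (path_space S) path0_le.

(* The endpoint m(a). *)
Definition path_end a : S := last \bot (path_seq a).

Fact path_pred_subproof a : covering_path (take (size a).-1 a).
Proof. by rewrite /covering_path take_path//; exact: (valP a). Qed.

(* The path a^-, meaningful for a != \bot. *)
Definition path_pred a : path_space S := PathSpace (path_pred_subproof a).

(* The path space satisfies the assumptions made on S. *)
Lemma discrete_path_space :
  discrete_poset S -> discrete_poset (path_space S).
Proof.
move=> [/countable_injP[f f_inj] _]; split.
  apply/countable_injP; exists (fun a => pickle (map f (path_seq a))).
  move=> a b _ _ /(pcan_inj pickleK) /inj_map fab; apply: val_inj.
  by apply: fab => x y; apply: f_inj; rewrite inE.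
move=> a C [_ _ _ Ca].
have fin_img := finite_image (fun k => insubd path0 (take k (path_seq a)))
  (finite_II (size (path_seq a)).+1).
apply: sub_finite_set fin_img => b /Ca /andP[_ ba]; exists (size b) => /=.
  by rewrite ltnS; exact: size_prefix ba.
have : prefix b a by [].
by rewrite prefixE => /eqP ->; exact: valKd.
Qed.

(* a^- is the unique element covered by a. *)
Lemma covers_pathP a b : covers a b <-> b != \bot /\ a = path_pred b.
Proof.
have pred_lt (c : path_space S) : c != \bot -> path_pred c < c.
  move=> c0; rewrite lt_neqAle; apply/andP; split; last exact: prefix_take.
  apply/eqP => /(congr1 (fun z : path_space S => size z)) /=.
  rewrite size_takel ?leq_pred// => /eqP.
  have : (0 < size c)%N.
    rewrite lt0n; apply: contraNneq c0 => /size0nil c0.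
    exact/eqP/val_inj.
  by case: (size c) => //= n _; rewrite ltn_eqF.
have le_pred (c c' : path_space S) : c < c' -> c <= path_pred c'.
  rewrite lt_neqAle => /andP[cc' ccle].
  have : prefix c c' by [].
  suff: prefix c c' -> prefix c (path_pred c') by [].
  rewrite !prefixE /= => /eqP cE; rewrite take_takel ?cE//.
  have : (size c <= size c')%N by exact: size_prefix ccle.
  rewrite leq_eqVlt => /orP[/eqP szE|szlt]; last first.
    by rewrite -ltnS (ltn_predK szlt).
  move/eqP: cc'; case; apply: val_inj => /=.
  by rewrite -cE szE take_size.
split=> [[/= ab nab]|[b0 ->]].
  have b0 : b != \bot.
    by apply: contraTneq ab => ->; rewrite ltx0.
  split => //; apply/eqP; apply/negP => /negP neq; apply: nab.
  exists (path_pred b); last exact: pred_lt.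
  by rewrite /= lt_neqAle neq le_pred.
split; first exact: pred_lt.
move=> [t /= lt1 /le_pred le2].
by move: (lt_le_trans lt1 le2); rewrite ltxx.
Qed.

End PathSpaceOrder.

(** * Markov chains *)

Local Open Scope ring_scope.

Definition transition_function (R : realType) (S : choiceType)
    (Q : S -> S -> R) : Prop :=
  (forall x y, 0 <= Q x y) /\
  (forall x, \esum_(y in [set: S]) (Q x y)%:E = 1%E).

Definition cond_prob (R : realType) (dO : measure_display)
    (Omega : measurableType dO) (P : probability Omega R)
    (B A : set Omega) : R :=
  fine (P (B `&` A)) / fine (P A).

(* S carries the discrete sigma-algebra. *)
Definition markov_chain (R : realType) (dO : measure_display)
    (Omega : measurableType dO) (P : probability Omega R) (S : choiceType)
    (Q : S -> S -> R) (Y : nat -> Omega -> S) : Prop :=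
  [/\ transition_function Q,
      forall n (A : set S), measurable (Y n @^-1` A) &
      forall (n : nat) (x : nat -> S) (y : S),
        let past := [set w | forall i, (i <= n)%N -> Y i w = x i] in
        P past != 0%E ->
        cond_prob P [set w | Y n.+1 w = y] past = Q (x n) y].

Definition downward_run_transition (R : realType) (d : Order.disp_t)
    (S : bPOrderType d) (Q : S -> S -> R) : Prop :=
  transition_function Q /\
  forall x y, 0 < Q x y <->
    x = \bot%O \/ (x <> \bot%O /\ covered_by x y).

Definition downward_run_chain (R : realType) (dO : measure_display)
    (Omega : measurableType dO) (P : probability Omega R)
    (d : Order.disp_t) (S : bPOrderType d)
    (Q : S -> S -> R) (Y : nat -> Omega -> S) : Prop :=
  markov_chain P Q Y /\ downward_run_transition Q.

Definition starts_at (R : realType) (dO : measure_display)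
    (Omega : measurableType dO) (P : probability Omega R) (S : Type)
    (Y : nat -> Omega -> S) (x : S) : Prop :=
  P [set w | Y 0%N w = x] = 1%E.

(* With x_0 = e, the value at (e, e x_1 ... x_n) is
   Q(e, x_n) * prod_(0 <= i < n) Q(x_(i+1), x_i). *)
Definition path_transition (R : realType) (d : Order.disp_t)
    (S : bPOrderType d) (Q : S -> S -> R) (a b : path_space S) : R :=
  if a == \bot%O then
    if b == \bot%O then Q \bot%O \bot%O
    else let x := nth \bot%O (\bot%O :: path_seq b) in
         Q \bot%O (path_end b) * \prod_(i < size b) Q (x i.+1) (x i)
  else (b == path_pred a)%:R.

(* Main.v *)
Require Import Defs.

Set Implicit Arguments.
Unset Strict Implicit.
Unset Printing Implicit Defensive.

(** The endpoint map m is a lumping of the path chain, and the theorem is an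
   instance of the intertwining criterion of Rogers and Pitman for a function
   of a Markov chain to be a Markov chain.

   For a path a = e x_1 ... x_n put L(a) = Q(x_n, x_{n-1}) ... Q(x_1, e)
   ([descent_prob]), the probability that a run descending from m(a) retraces a
   backwards.  Two facts about L carry the proof.

   - Intertwining ([descent_prob_intertwining]): the sum over the paths a with
     endpoint x of L(a) Qhat(a, b) is Q(x, m(b)) L(b).  If x = e, only the
     degenerate path contributes and this is the definition of Qhat(e, b).  If
     x <> e, only the path b x contributes, and L(b x) = Q(x, m(b)) L(b); when
     b x is not a path, x does not cover m(b) and Q(x, m(b)) = 0.

   - Normalization ([descent_prob_sum1]): for every x, L is a probability on the
     paths with endpoint x, i.e. a descending run from x reaches e.  Finiteness
     of the chains from e to x excludes infinite descent, so one can argue by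
     well-founded induction: writing 1 as the sum of Qhat(a, b) over b,
     exchanging the sums and using the intertwining turns the total mass over x
     into the sum over y of Q(x, y) times the total mass over y.

   Normalization also gives that the rows of Qhat sum to 1.  For the chain, the
   intertwining propagates the following invariant from n to n + 1: given
   Y_0, ..., Y_n, the conditional law of the path at time n is L on the paths
   with endpoint Y_n ([intertwining_filter]).  It holds at time 0 because the
   chain starts at the degenerate path.  Hence the next path is b with
   conditional probability Q(Y_n, m(b)) L(b), and summing over the paths b with
   endpoint y leaves Q(Y_n, y). *)

Local Open Scope classical_set_scope.
Local Open Scope ring_scope.

(** * Sums over arbitrary index sets *)

Lemma esumZl (R : realType) (T : choiceType) (I : set T) (r : R)
    (f : T -> \bar R) :
  0 <= r -> (forall t, (0 <= f t)%E) ->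
  \esum_(t in I) (r%:E * f t)%E = (r%:E * \esum_(t in I) f t)%E.
Proof.
move=> r0 f0; rewrite /esum -ereal_supZl//; last first.
  apply/set0P; exists (\sum_(x \in set0) f x)%E => /=.
  by exists set0 => //; exact: fsets_set0.
congr ereal_sup; rewrite image_comp; apply: eq_imagel => A _ /=.
by rewrite ge0_mule_fsumr.
Qed.

Lemma exchange_esum (R : realType) (T U : choiceType) (I : set T) (J : set U)
    (f : T -> U -> \bar R) :
  (forall t u, (0 <= f t u)%E) ->
  \esum_(t in I) \esum_(u in J) f t u = \esum_(u in J) \esum_(t in I) f t u.
Proof.
move=> f0; rewrite !esum_esum//.
rewrite (reindex_esum (J `*`` fun=> I) _ (fun x => (x.2, x.1)))//.
split=> //=; first by move=> [u t] [].
- by move=> [u t] [u' t'] _ _ /= [-> ->].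
- by move=> [t u] [/= It Ju]; exists (u, t).
Qed.

Lemma esum_fibers (R : realType) (T U : choiceType) (g : T -> U)
    (f : T -> \bar R) :
  (forall t, (0 <= f t)%E) ->
  \esum_(t in [set: T]) f t =
  \esum_(u in [set: U]) \esum_(t in [set t | g t = u]) f t.
Proof.
move=> f0; rewrite esum_esum//.
rewrite (reindex_esum [set: T] _ (fun t => (g t, t)))//; split=> //.
- by move=> s t _ _ [].
- by move=> [u t] [/= _ <-]; exists t.
Qed.

(** * Markov chains on a countable state space *)

Lemma measure_fibers (R : realType) (dO : measure_display)
    (Omega : measurableType dO) (mu : {measure set Omega -> \bar R})
    (T : choiceType) (X : Omega -> T) (E : set Omega) :
  countable [set: T] -> measurable E ->
  (forall t, measurable [set w | X w = t]) ->
  mu E = \esum_(t in [set: T]) mu (E `&` [set w | X w = t]).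
Proof.
move=> /countable_injP[g g_inj] mE mX.
have gI : injective g by move=> s t; apply: g_inj; rewrite inE.
have gX n : measurable [set w | g (X w) = n].
  have [[t <-]|ng] := pselect (exists t, g t = n).
    rewrite (_ : mkset _ = [set w | X w = t]) //.
    by apply/seteqP; split=> w /= => [/gI|->].
  rewrite (_ : mkset _ = set0)//; apply/seteqP; split=> // w /= gw.
  by apply: ng; exists (X w).
have mEn n : measurable (E `&` [set w | g (X w) = n]) by exact: measurableI.
have {1}-> : E = \bigcup_n (E `&` [set w | g (X w) = n]).
  apply/seteqP; split=> [w Ew|w [n _ []]//].
  by exists (g (X w)).
rewrite measure_bigcup//; last by move=> m n _ _ [w [[/= _ <-] [_ <-]]].
(* Outside the range of the numbering g of T the fibers are empty. *)
rewrite nneseries_esum// (esumID (range g))//.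
rewrite [X in (_ + X)%E]esum1 ?adde0; last first.
  move=> n [_ ng]; rewrite (_ : _ `&` _ = set0) ?measure0//.
  apply/seteqP; split=> // w [/= _ gw]; apply: ng.
  by exists (X w).
rewrite (_ : _ `&` _ = range g); last first.
  by apply/seteqP; split=> n /=; [case | split; rewrite ?inE].
rewrite esum_image; last by move=> s t _ _ /gI.
apply: eq_esum => t _; congr (mu (_ `&` _)).
by apply/seteqP; split=> w /= => [/gI|->].
Qed.

Arguments measure_fibers {R dO Omega} mu {T} X E.

Lemma cylinder_measurable (dO : measure_display)
    (Omega : measurableType dO) (T : choiceType) (X : nat -> Omega -> T)
    (D : nat -> set T) n :
  (forall n A, measurable (X n @^-1` A)) ->
  measurable [set w | forall i, (i <= n)%N -> D i (X i w)].
Proof.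
move=> mX; rewrite (_ : mkset _ = \bigcap_(i in `I_n.+1) (X i @^-1` D i)).
  exact: bigcap_measurableType.
by [].
Qed.

Arguments cylinder_measurable {dO Omega T X} D {n}.

(** Restates the definition with the intersection of sets in place of the meet
   of the lattice of sets, to which it is only convertible. *)
Lemma cond_probE (R : realType) (dO : measure_display)
    (Omega : measurableType dO) (P : probability Omega R) (B A : set Omega) :
  cond_prob P B A = fine (P (B `&` A)) / fine (P A).
Proof. by []. Qed.

(** The product form of the Markov property, which unlike the conditional one
   also holds on null pasts, so that it can be summed over pasts. *)
Lemma markov_chain_joint (R : realType) (dO : measure_display)
    (Omega : measurableType dO) (P : probability Omega R) (T : choiceType)
    (Q : T -> T -> R) (X : nat -> Omega -> T) (n : nat) (x : nat -> T) (y : T) :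
  markov_chain P Q X ->
  let past := [set w | forall i, (i <= n)%N -> X i w = x i] in
  P (past `&` [set w | X n.+1 w = y]) = (P past * (Q (x n) y)%:E)%E.
Proof.
move=> [_ mX mar] past.
have mpast : measurable past.
  exact: (cylinder_measurable (fun i => [set x i])).
have mpasty : measurable (past `&` [set w | X n.+1 w = y]).
  by apply: measurableI => //; exact: (mX n.+1 [set y]).
have [P0|P0] := eqVneq (P past) 0%E.
  rewrite P0 mul0e; apply/eqP; rewrite eq_le measure_ge0 andbT -P0.
  by apply: le_measure; rewrite ?inE//; exact: subIsetl.
have fP0 : fine (P past) != 0 by rewrite fine_eq0// fin_num_measure.
have /(congr1 (fun r => (fine (P past) * r)%:E)) := mar n x y P0.
rewrite cond_probE -/past setIC mulrCA mulfV// mulr1 EFinM.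
by rewrite !fineK// fin_num_measure.
Qed.

(** The Markov property given X_n = a persists when the exact past is coarsened
   to X_i in D_i: the event is a countable disjoint union of exact pasts, and
   all of them predict the next state through the same factor Q(a, b). *)
Lemma markov_chain_cylinder (R : realType) (dO : measure_display)
    (Omega : measurableType dO) (P : probability Omega R) (T : choiceType)
    (Q : T -> T -> R) (X : nat -> Omega -> T) (n : nat) (D : nat -> set T)
    (a b : T) :
  countable [set: T] -> markov_chain P Q X ->
  let E := [set w | forall i, (i <= n)%N -> D i (X i w)] `&`
           [set w | X n w = a] in
  P (E `&` [set w | X n.+1 w = b]) = (P E * (Q a b)%:E)%E.
Proof.
move=> cT mcX E; have [[Q0 _] mX _] := mcX.
have mE : measurable E.
  apply: measurableI; first exact: cylinder_measurable.
  exact: (mX n [set a]).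
have mb : measurable [set w | X n.+1 w = b] by exact: (mX n.+1 [set b]).
pose hist w := mkseq (X^~ w) n.+1.
have histP w w0 : hist w = hist w0 <-> forall i, (i <= n)%N -> X i w = X i w0.
  rewrite /hist /mkseq -eq_in_map; split=> XX i.
    by move=> ile; apply: XX; rewrite mem_iota.
  by rewrite mem_iota add0n ltnS => /XX.
have mhist t : measurable [set w | hist w = t].
  have [[w0 <-]|no] := pselect (exists w0, hist w0 = t).
    rewrite (_ : mkset _ = [set w | forall i, (i <= n)%N -> X i w = X i w0]).
      exact: (cylinder_measurable (fun i => [set X i w0])).
    by apply/seteqP; split=> w /histP.
  rewrite (_ : mkset _ = set0)//; apply/seteqP; split=> // w hw.
  by apply: no; exists w.
have cseq : countable [set: seq T].
  have /countable_injP[f f_inj] := cT.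
  apply/countable_injP; exists (fun s => pickle (map f s)).
  move=> s t _ _ /(pcan_inj pickleK) /inj_map; apply.
  by move=> u v; apply: f_inj; rewrite inE.
(* Each event hist = t is either disjoint from E or an exact past inside E. *)
rewrite (measure_fibers P hist E cseq mE)//.
rewrite (measure_fibers P hist (E `&` _) cseq)//; last exact: measurableI.
rewrite muleC -esumZl//; apply: eq_esum => t _.
rewrite -setIA [X in E `&` X]setIC setIA.
have [[w0 [Ew0 hw0]]|no] := pselect (exists w0, E w0 /\ hist w0 = t);
  last first.
  rewrite (_ : E `&` [set w | hist w = t] = set0) ?set0I ?measure0 ?mule0//.
  by apply/seteqP; split=> // w [Ew hw]; apply: no; exists w.
rewrite (_ : E `&` [set w | hist w = t] =
    [set w | forall i, (i <= n)%N -> X i w = X i w0]).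
  have /= -> := markov_chain_joint n (X^~ w0) b mcX; rewrite muleC.
  by case: Ew0 => _ /= ->.
apply/seteqP; split=> w /=.
  by rewrite -hw0 => -[_] /histP.
move=> ww0; split; last by rewrite -hw0; apply/histP.
case: Ew0 => DX Xa; split; last by rewrite /= ww0.
by move=> i ile; rewrite ww0//; exact: DX.
Qed.

Arguments markov_chain_cylinder {R dO Omega P T Q X} n D a b.

(** * Functions of Markov chains *)

(** L, restricted to the fiber of f over u, is the candidate for the conditional
   law of the state of the chain given that its image under f is u; this is a
   Markov kernel from U to T that intertwines K and Q. *)
Section intertwining.
Context (R : realType) (T U : choiceType) (f : T -> U).
Context (Q : T -> T -> R) (K : U -> U -> R) (L : T -> R).
Hypothesis cT : countable [set: T].
Hypothesis K_tr : transition_function K.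
Hypothesis L_ge0 : forall a, 0 <= L a.
Hypothesis L_sum1 : forall u, \esum_(a in [set a | f a = u]) (L a)%:E = 1%E.
Hypothesis L_Q : forall u b,
  \esum_(a in [set a | f a = u]) (L a * Q a b)%:E = (K u (f b) * L b)%:E.
Context (dO : measure_display) (Omega : measurableType dO)
  (P : probability Omega R) (X : nat -> Omega -> T).
Hypothesis X_mc : markov_chain P Q X.
Hypothesis X_init : forall a,
  P [set w | X 0%N w = a] = (P [set w | f (X 0%N w) = f a] * (L a)%:E)%E.

Let past n (u : nat -> U) := [set w | forall i, (i <= n)%N -> f (X i w) = u i].

Let X_meas n A : measurable (X n @^-1` A).
Proof. by have [_ + _] := X_mc; apply. Qed.

Let past_meas n u : measurable (past n u).
Proof.
exact: (cylinder_measurable (fun i => [set a | f a = u i])).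
Qed.

Let X_eq_meas n a : measurable [set w | X n w = a].
Proof. exact: (X_meas n [set a]). Qed.

Let past_fin n u : P (past n u) = (fine (P (past n u)))%:E.
Proof. by rewrite fineK// fin_num_measure. Qed.

(** Conditioning on the current state turns the law L at time n into the sum of
   L(a) Q(a, b) over the fiber, which the intertwining evaluates. *)
Lemma intertwining_predict n u b :
  (forall a, f a = u n ->
    P (past n u `&` [set w | X n w = a]) = (P (past n u) * (L a)%:E)%E) ->
  P (past n u `&` [set w | X n.+1 w = b]) =
  (P (past n u) * (K (u n) (f b) * L b)%:E)%E.
Proof.
move=> cond; have [[Q0 _] _ _] := X_mc.
rewrite (measure_fibers P (X n) (_ `&` _) cT)//; last exact: measurableI.
rewrite -L_Q [in RHS]past_fin -esumZl ?fine_ge0//; last first.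
  by move=> a; rewrite lee_fin mulr_ge0.
rewrite [RHS]esum_mkcond; apply: eq_esum => a _.
rewrite -setIA [X in _ `&` X]setIC setIA.
have /= -> :=
  markov_chain_cylinder n (fun i => [set a | f a = u i]) a b cT X_mc.
case: ifPn => [|/negP]; rewrite inE/= => fa.
  by rewrite (cond a fa) -past_fin EFinM muleA.
rewrite (_ : _ `&` _ = set0) ?measure0 ?mul0e//.
apply/seteqP; split=> // w [/= pw Xw]; apply: fa.
by rewrite -Xw; exact: pw.
Qed.

Lemma intertwining_step n u v :
  (forall b, P (past n u `&` [set w | X n.+1 w = b]) =
    (P (past n u) * (K (u n) (f b) * L b)%:E)%E) ->
  P (past n u `&` [set w | f (X n.+1 w) = v]) =
  (P (past n u) * (K (u n) v)%:E)%E.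
Proof.
move=> pred; have mv : measurable [set w | f (X n.+1 w) = v].
  exact: (X_meas n.+1 [set a | f a = v]).
rewrite (measure_fibers P (X n.+1) (_ `&` _) cT)//; last exact: measurableI.
have L0 a : (0 <= (L a)%:E)%E by rewrite lee_fin.
have K0 : 0 <= K (u n) v by exact: K_tr.1.
rewrite -[(K _ _)%:E]mule1 -(L_sum1 v) -esumZl//.
rewrite [in RHS]past_fin -esumZl ?fine_ge0//; last first.
  by move=> a; rewrite mule_ge0.
rewrite [RHS]esum_mkcond; apply: eq_esum => b _.
case: ifPn => [|/negP]; rewrite inE/= => fb.
  rewrite -past_fin -EFinM -[in RHS]fb -pred; congr (P _).
  apply/seteqP; split=> w [/=]; first by move=> [? _].
  by move=> pw Xw; rewrite Xw.
rewrite (_ : _ `&` _ = set0) ?measure0//.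
by apply/seteqP; split=> // w [[/= _ fw] Xw]; apply: fb; rewrite -Xw.
Qed.

(** The invariant of the proof: given the past of the image process, the state
   of the chain is distributed according to L on the current fiber.  At time
   n + 1 one conditions the law of the next state on its fiber; in product form
   this says that the law and its mass on the fiber share the factor
   K(u_n, u_{n+1}). *)
Lemma intertwining_filter n u a : f a = u n ->
  P (past n u `&` [set w | X n w = a]) = (P (past n u) * (L a)%:E)%E.
Proof.
elim: n u a => [|n IHn] u a fa.
  have -> : past 0 u = [set w | f (X 0%N w) = f a].
    apply/seteqP; split=> w /= => [/(_ 0%N)|fX i]; first by rewrite fa; apply.
    by rewrite leqn0 => /eqP ->; rewrite fX.
  rewrite -X_init; congr (P _).
  by apply/seteqP; split=> w /= => [[]//|Xw]; split=> //; rewrite Xw.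
have pred b := intertwining_predict b (IHn u).
have pastS : past n.+1 u = past n u `&` [set w | f (X n.+1 w) = u n.+1].
  apply/seteqP; split=> w /=.
    by move=> pw; split=> [i ile|]; apply: pw => //; exact: leqW.
  by move=> [pw fX] i; rewrite leq_eqVlt => /orP[/eqP ->//|]; exact: pw.
rewrite [in RHS]pastS intertwining_step// -muleA -EFinM -fa -pred; congr (P _).
rewrite pastS; apply/seteqP; split=> w /= => [[[]]//|[pw Xw]].
by rewrite Xw.
Qed.

(** The Rogers-Pitman criterion: the past of the image process determines the
   conditional law of the current state only through the current image, namely
   as L on its fiber, so the prediction depends on the current image alone. *)
Theorem intertwining_markov_chain : markov_chain P K (fun n w => f (X n w)).
Proof.
split=> // [n A|n u v /= P0]; first exact: (X_meas n (f @^-1` A)).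
have joint := intertwining_step v
  (fun b => intertwining_predict b (fun a => @intertwining_filter n u a)).
rewrite cond_probE setIC -/(past n u) joint past_fin -EFinM/=.
rewrite mulrAC mulfV ?mul1r//.
by rewrite fine_eq0// fin_num_measure.
Qed.

End intertwining.

(** * Induction on a discrete poset *)

(** An infinite strictly descending sequence from x would form, together with
   the minimum element, an infinite chain from the minimum element to x. *)
Lemma discrete_poset_ind (d : Order.disp_t) (S : bPOrderType d)
    (p : S -> Prop) :
  discrete_poset S ->
  (forall x, (forall y, (y < x)%O -> p y) -> p x) -> forall x, p x.
Proof.
move=> [_ fin_chain] p_ind x; apply: contrapT => npx.
pose bad := {z : S | ~ p z}.
have descend (z : bad) : {y : bad | (sval y < sval z)%O}.
  apply: cid; apply: contrapT => none; apply: (svalP z); apply: p_ind => y yz.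
  by apply: contrapT => npy; apply: none; exists (exist _ y npy).
have [g [g0 g_lt]] := dependent_choice descend (exist _ x npx).
pose h n := sval (g n).
have h_le m n : (m <= n)%N -> (h n <= h m)%O.
  by apply: (homo_leq (r := fun a b => b <= a)%O) => // [b a c ba cb|k];
    [exact: le_trans cb ba|exact/ltW/g_lt].
have h_inj : injective h.
  suff lt_neq m n : (m < n)%N -> h m != h n.
    move=> m n /eqP hmn; case: (ltngtP m n) => // /lt_neq; first by rewrite hmn.
    by rewrite eq_sym hmn.
  move=> mn; rewrite eq_sym lt_eqF//.
  by apply: le_lt_trans (h_le _ _ mn) _; exact: g_lt.
have /fin_chain : chain_between \bot%O x ([set \bot%O] `|` range h).
  split; last 1 first.
  - move=> _ [->|[n _ <-]]; rewrite ?lexx le0x//=.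
    by have := h_le 0%N n (leq0n n); rewrite /h g0.
  - move=> _ _ [->|[m _ <-]] [->|[n _ <-]]; rewrite ?le0x;
      [by left..|by right|].
    by case/orP: (leq_total m n) => /h_le; [right|left].
  - by left.
  - by right; exists 0%N => //; rewrite /h g0.
rewrite finite_setU => -[_] fin_range; apply: infinite_nat.
rewrite -(preimage_range h); apply: finite_preimage fin_range.
exact: in2W h_inj.
Qed.

(** * Removing and adding the endpoint of a path *)

Section path_space.
Context (d : Order.disp_t) (S : bPOrderType d).
Implicit Types a b : path_space S.

Lemma covers_lt (x y : S) : covers x y -> (x < y)%O.
Proof. by case. Qed.

Lemma path_rconsP a : a != \bot%O ->
  [/\ path_seq a = rcons (path_pred a) (path_end a),
      covers (path_end (path_pred a)) (path_end a) & path_end a != \bot%O].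
Proof.
case: a => s; case/lastP: s => [p0|s x p0 _].
  by case/negP; apply/eqP/val_inj.
rewrite /path_end /= last_rcons.
have -> : take (size (rcons s x)).-1 (rcons s x) = s.
  by rewrite size_rcons -cats1 take_size_cat.
have cov : covers (last \bot%O s) x.
  by move: (p0); rewrite /covering_path rcons_path => /andP[_ /asboolP].
split=> //; apply: contraTneq (covers_lt cov) => ->.
by rewrite ltx0.
Qed.

Lemma path_end_eq0 a : (path_end a == \bot%O) = (a == \bot%O).
Proof.
apply/eqP/eqP => [a0|->//]; apply/eqP; apply: contraPT a0 => /path_rconsP[_ _].
by move=> /eqP.
Qed.

Lemma path_end_fiber0 :
  [set a | path_end a = \bot%O] = [set \bot%O : path_space S].
Proof.
by apply/seteqP; split=> a /= => [/eqP|->//]; rewrite path_end_eq0 => /eqP.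
Qed.

Lemma path_extend_subproof a x : covers (path_end a) x ->
  covering_path (rcons a x).
Proof.
move=> ax; rewrite /covering_path rcons_path; apply/andP.
by split; [exact: (valP a)|exact/asboolP].
Qed.

Definition path_extend a x (ax : covers (path_end a) x) : path_space S :=
  PathSpace (path_extend_subproof ax).

Lemma path_end_extend a x (ax : covers (path_end a) x) :
  path_end (path_extend ax) = x.
Proof. by rewrite /path_end /= last_rcons. Qed.

Lemma path_extend_neq0 a x (ax : covers (path_end a) x) :
  path_extend ax != \bot%O.
Proof.
rewrite -path_end_eq0 path_end_extend.
by apply: contraTneq (covers_lt ax) => ->; rewrite ltx0.
Qed.

Lemma path_pred_extend a x (ax : covers (path_end a) x) :
  path_pred (path_extend ax) = a.
Proof. by apply: val_inj; rewrite /= size_rcons -cats1 take_size_cat. Qed.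

Lemma path_predK a (ax : covers (path_end (path_pred a)) (path_end a)) :
  a != \bot%O -> path_extend ax = a.
Proof. by move=> /path_rconsP[aE _ _]; apply: val_inj; rewrite /= -aE. Qed.

End path_space.

(** * The law of a descending run *)

(** The probability that a run started at the endpoint of a descends through the
   vertices of a down to the minimum element.  The implicit starting point of a
   is put back in front, so x_0 is the minimum element and the entry of a at
   index i is x_(i + 1). *)
Definition descent_prob (R : realType) (d : Order.disp_t) (S : bPOrderType d)
    (Q : S -> S -> R) (a : path_space S) : R :=
  let x := nth \bot%O (\bot%O :: path_seq a) in
  \prod_(i < size a) Q (x i.+1) (x i).

Section descent.
Context (R : realType) (d : Order.disp_t) (S : bPOrderType d).
Context (Q : S -> S -> R).
Implicit Types a b : path_space S.

Lemma path_transition_bot b :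
  path_transition Q \bot%O b = Q \bot%O (path_end b) * descent_prob Q b.
Proof.
rewrite /path_transition eqxx; case: eqP => [->|//].
by rewrite /descent_prob big_ord0 mulr1.
Qed.

Lemma descent_prob_pred a : a != \bot%O ->
  descent_prob Q a =
  Q (path_end a) (path_end (path_pred a)) * descent_prob Q (path_pred a).
Proof.
move=> /path_rconsP[]; rewrite /descent_prob.
move: (path_pred a) => b; move: (path_end a) => x -> _ _.
rewrite size_rcons big_ord_recr/= mulrC; congr (Q _ _ * _).
- by rewrite nth_rcons ltnn eqxx.
- rewrite -rcons_cons nth_rcons/= ltnS leqnn /path_end -nth_last.
  by case: b => -[].
apply: eq_bigr => i _; rewrite nth_rcons ltn_ord; congr (Q _ _).
by rewrite -rcons_cons nth_rcons/= ltnS ltnW.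
Qed.

Hypothesis hQ : downward_run_transition Q.

Lemma descent_prob_ge0 a : 0 <= descent_prob Q a.
Proof. by apply: prodr_ge0 => i _; exact: hQ.1.1. Qed.

Lemma path_transition_ge0 a b : 0 <= path_transition Q a b.
Proof.
have [->|a0] := eqVneq a \bot%O; last by rewrite /path_transition (negPf a0).
by rewrite path_transition_bot mulr_ge0// ?descent_prob_ge0//; exact: hQ.1.1.
Qed.

Lemma descent_prob_gt0 a : 0 < descent_prob Q a.
Proof.
have [n] := ubnP (size a); elim: n a => // n IHn a an.
have [->|a0] := eqVneq a \bot%O; first by rewrite /descent_prob big_ord0.
have [aE cov end0] := path_rconsP a0.
rewrite descent_prob_pred// mulr_gt0//.
  by apply/hQ.2; right; split; [exact/eqP|].
by apply: IHn; move: an; rewrite aE size_rcons.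
Qed.

(** A path goes to b either from the minimum element, which is the whole fiber
   over its endpoint, or by losing its endpoint, so the only contribution to the
   fiber over x <> e is the extension of b by x. *)
Lemma descent_prob_intertwining x b :
  \esum_(a in [set a | path_end a = x])
    (descent_prob Q a * path_transition Q a b)%:E =
  (Q x (path_end b) * descent_prob Q b)%:E.
Proof.
have term0 a : (0 <= (descent_prob Q a * path_transition Q a b)%:E)%E.
  by rewrite lee_fin mulr_ge0 ?descent_prob_ge0 ?path_transition_ge0.
have [->|x0] := eqVneq x \bot%O.
  rewrite path_end_fiber0 esum_set1// path_transition_bot.
  by rewrite {1}/descent_prob big_ord0 mul1r.
have neq0 a : path_end a = x -> a != \bot%O by rewrite -path_end_eq0 => ->.
have [cov|ncov] := pselect (covers (path_end b) x).
  rewrite (esumID [set path_extend cov])//.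
  rewrite [X in (_ + X)%E]esum1 ?adde0; last first.
    move=> a [/= ax na]; rewrite /path_transition (negPf (neq0 _ ax)).
    case: eqP => [bE|]; last by rewrite mulr0.
    subst b x; case: na; rewrite path_predK//; exact: neq0.
  rewrite (_ : _ `&` _ = [set path_extend cov]); last first.
    apply/seteqP; split=> a /= => [[]//|->]; split=> //; exact: path_end_extend.
  rewrite esum_set1// /path_transition (negPf (path_extend_neq0 cov)).
  rewrite path_pred_extend eqxx mulr1 descent_prob_pred ?path_extend_neq0//.
  by rewrite path_end_extend path_pred_extend.
have -> : Q x (path_end b) = 0.
  apply/eqP; rewrite eq_le hQ.1.1 andbT leNgt; apply/negP => /hQ.2 [/eqP|[_]//].
  exact/negP.
rewrite mul0r esum1// => a /= ax; rewrite /path_transition (negPf (neq0 _ ax)).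
case: eqP => [bE|]; last by rewrite mulr0.
by have [_ + _] := path_rconsP (neq0 _ ax); rewrite -bE ax.
Qed.

Lemma path_transition_sum1_neq0 a : a != \bot%O ->
  \esum_(b in [set: path_space S]) (path_transition Q a b)%:E = 1%E.
Proof.
move=> a0; rewrite (esumID [set path_pred a]); last first.
  by move=> b _; rewrite lee_fin path_transition_ge0.
rewrite setTI esum_set1; last by rewrite lee_fin path_transition_ge0.
rewrite /path_transition (negPf a0) eqxx esum1 ?adde0// => b [_ /= /eqP].
by move=> /negPf ->.
Qed.

(** Grouping the paths b by their endpoint y leaves Q(x, y) times the mass of L
   over y.  That mass is required to be 1 only where Q(x, y) > 0, because an
   induction over the poset supplies it only for the y below x. *)
Lemma descent_prob_step x :
  (forall y, 0 < Q x y ->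
    \esum_(b in [set b | path_end b = y]) (descent_prob Q b)%:E = 1%E) ->
  \esum_(b in [set: path_space S]) (Q x (path_end b) * descent_prob Q b)%:E
  = 1%E.
Proof.
move=> sum1; rewrite (esum_fibers (@path_end d S)); last first.
  by move=> b; rewrite lee_fin mulr_ge0 ?descent_prob_ge0//; exact: hQ.1.1.
rewrite -(hQ.1.2 x); apply: eq_esum => y _.
transitivity (\esum_(b in [set b | path_end b = y])
    ((Q x y)%:E * (descent_prob Q b)%:E)%E).
  by apply: eq_esum => b /= <-.
rewrite esumZl; [|exact: hQ.1.1|by move=> b; rewrite lee_fin descent_prob_ge0].
have [/sum1 ->|Qxy] := ltP 0 (Q x y); first by rewrite mule1.
have -> : Q x y = 0 by apply/eqP; rewrite eq_le Qxy hQ.1.1.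
by rewrite mul0e.
Qed.

Hypothesis hS : discrete_poset S.

(** Each path a over x <> e has total transition probability 1, so the mass of
   the fiber over x is a double sum of L(a) Qhat(a, b); summing over a first,
   the intertwining reduces it to the masses of the fibers over the y < x. *)
Lemma descent_prob_sum1 x :
  \esum_(a in [set a | path_end a = x]) (descent_prob Q a)%:E = 1%E.
Proof.
move: x; apply: (discrete_poset_ind hS) => x IHx.
have [->|x0] := eqVneq x \bot%O.
  by rewrite path_end_fiber0 esum_set1 /descent_prob big_ord0.
transitivity (\esum_(a in [set a | path_end a = x])
    \esum_(b in [set: path_space S])
      (descent_prob Q a * path_transition Q a b)%:E).
  apply: eq_esum => a /= ax; under eq_esum do rewrite EFinM.
  rewrite esumZl ?descent_prob_ge0//; last first.
    by move=> b; rewrite lee_fin path_transition_ge0.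
  by rewrite path_transition_sum1_neq0 ?mule1// -path_end_eq0 ax.
rewrite exchange_esum; last first.
  move=> a b; rewrite lee_fin.
  by rewrite mulr_ge0 ?descent_prob_ge0 ?path_transition_ge0.
under eq_esum do rewrite descent_prob_intertwining.
apply: descent_prob_step => y /hQ.2[/eqP|[_ /covers_lt]]; last exact: IHx.
by rewrite (negPf x0).
Qed.

Lemma path_transition_downward_run :
  downward_run_transition (path_transition Q).
Proof.
split; first split; first exact: path_transition_ge0.
- move=> a; have [->|/path_transition_sum1_neq0//] := eqVneq a \bot%O.
  under eq_esum do rewrite path_transition_bot.
  by apply: descent_prob_step => y _; exact: descent_prob_sum1.
move=> a b; have [->|a0] := eqVneq a \bot%O.
  split=> _; first by left.
  rewrite path_transition_bot mulr_gt0 ?descent_prob_gt0//.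
  by apply/hQ.2; left.
rewrite /path_transition (negPf a0) ltr0n lt0b; split=> [/eqP ->|].
  by right; split; [exact/eqP|exact/covers_pathP].
move=> [/eqP|[_ /covers_pathP[_ ->]]]; by [rewrite (negPf a0)|rewrite eqxx].
Qed.

End descent.

Theorem proposition4 (R : realType) (d : Order.disp_t) (S : bPOrderType d)
    (hS : discrete_poset S) (Q : S -> S -> R)
    (hQ : downward_run_transition Q) :
  downward_run_transition (path_transition Q) /\
  forall (dO : measure_display) (Omega : measurableType dO)
    (P : probability Omega R) (Yhat : nat -> Omega -> path_space S),
    downward_run_chain P (path_transition Q) Yhat ->
    starts_at P Yhat \bot%O ->
    let Y := fun n w => path_end (Yhat n w) in
    downward_run_chain P Q Y /\ starts_at P Y \bot%O.
Proof.
split; first exact: path_transition_downward_run.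
move=> dO Omega P Yhat [mc _] start Y.
have startY : starts_at P Y \bot%O.
  rewrite /starts_at /Y -[RHS]start; congr (P _).
  by apply/seteqP; split=> w /= => [/eqP|->//]; rewrite path_end_eq0 => /eqP.
split=> //; split=> //; have [_ mY _] := mc.
have meas (A : set (path_space S)) : measurable [set w | A (Yhat 0%N w)].
  exact: mY.
have null (A : set (path_space S)) : ~ A \bot%O ->
    P [set w | A (Yhat 0%N w)] = 0%E.
  move=> nA; apply/eqP; rewrite eq_le measure_ge0 andbT.
  rewrite -[0%E](_ : (1 - P [set w | Yhat 0%N w = \bot%O])%E = 0%E); last first.
    by rewrite start subee.
  rewrite -probability_setC; last exact: (meas [set \bot%O]).
  apply: le_measure; rewrite ?inE//.
    by apply: measurableC; exact: (meas [set \bot%O]).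
  by move=> w /= Aw /= w0; apply: nA; rewrite -w0.
(* The initial law is a point mass at the degenerate path, which is the law L on
   the fiber over the minimum element; every other fiber is null. *)
apply: (intertwining_markov_chain (L := descent_prob Q)) mc _ => //.
- by have [] := discrete_path_space hS.
- exact: hQ.1.
- exact: descent_prob_ge0.
- exact: descent_prob_sum1.
- exact: descent_prob_intertwining.
move=> a; have [->|a0] := eqVneq a \bot%O.
  by rewrite [LHS]start startY mul1e /descent_prob big_ord0.
rewrite (null [set a])/= => [|/esym/eqP]; last by rewrite (negPf a0).
rewrite (null [set b | path_end b = path_end a])/= ?mul0e//.
by move=> /esym/eqP; rewrite path_end_eq0 (negPf a0).
Qed.
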